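(* Let $m\geq 1$ be a fixed integer. For each $n\in\mathbb{N}$, let $P_n$ be a random polynomial chosen according to the Bombieri Gaussian measure $\gamma_{m,n}$ on the space $\mathcal{P}_m(\mathbb{R}^n)$ of real $m$-homogeneous polynomials on $\mathbb{R}^n$. Then, as $n\to\infty$, $$1-\frac{V(P_n)}{M(P_n)}=O_{\mathbb{P}}(n^{-1/2}),$$ where $M(P)=\max_{x\in[-1,1]^n}|P(x)|$ and $V(P)=\max_{\varepsilon\in\{-1,1\}^n}|P(\varepsilon)|$.
   Context: $\mathcal{P}_m(\mathbb{R}^n)$ is the real vector space of polynomials $P:\mathbb{R}^n\to\mathbb{R}$ that are $m$-homogeneous, i.e. $P(x)=\sum_{\alpha\in\mathbb{N}_0^n,\,|\alpha|=m}a_\alpha x^\alpha$, where $|\alpha|=\alpha_1+\cdots+\alpha_n$ and $x^\alpha=x_1^{\alpha_1}\cdots x_n^{\alpha_n}$. The Bombieri norm is $\|P\|_B^2=\sum_{|\alpha|=m}a_\alpha^2\,\frac{\alpha!}{m!}$ with $\alpha!=\alpha_1!\cdots\alpha_n!$. The measure $\gamma_{m,n}$ is the standard Gaussian measure of the Hilbert space $(\mathcal{P}_m(\mathbb{R}^n),\|\cdot\|_B)$; that is, it is the law of $$P_n(x)=\sum_{|\alpha|=m}\sqrt{\tbinom{m}{\alpha}}\,g_\alpha x^\alpha,\qquad \tbinom{m}{\alpha}=\frac{m!}{\alpha_1!\cdots\alpha_n!},$$ where $(g_\alpha)_{|\alpha|=m}$ are independent standard real Gaussian random variables. The ratio $V(P_n)/M(P_n)$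 is defined whenever $P_n\neq 0$, which holds with probability one. For nonnegative random variables $(A_n)$ and positive numbers $(a_n)$, $A_n=O_{\mathbb{P}}(a_n)$ means: for every $\eta>0$ there exists $C>0$ such that $\mathbb{P}(A_n>Ca_n)<\eta$ for all sufficiently large $n$. *)

(* Defs.v *)
From HB Require Import structures.
From mathcomp Require Import all_boot all_order all_algebra.
From mathcomp Require Import all_classical all_reals all_analysis.
(* The notations of mpoly clash with those of MathComp-Analysis. *)
From mathcomp Require Import -(notations) mpoly.

Set Implicit Arguments.
Unset Strict Implicit.
Unset Printing Implicit Defensive.

Import Order.TTheory GRing.Theory Num.Theory.
Import numFieldNormedType.Exports.

Local Open Scope classical_set_scope.
Local Open Scope ring_scope.

Notation multi_index n m :=
  {a : bmultinom n m.+1 | mdeg (bmnm a) == m%N}.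

Definition exponent (n m : nat) (a : multi_index n m) : multinom n :=
  bmnm (val a).

Definition multinomial_coef (R : realType) (n m : nat) (a : multi_index n m)
    : R :=
  m`!%:R / (\prod_(i < n) (exponent a i)`!)%N%:R.

Definition mutual_independence (R : realType) (d : measure_display)
    (T : measurableType d) (P : probability T R) (I : finType)
    (g : I -> {RV P >-> R}) : Prop :=
  forall (J : {set I}) (B : I -> set R),
    (forall i, measurable (B i)) ->
    P (\bigcap_(i in [set` J]) (g i @^-1` B i)) =
    (\prod_(i in J) P (g i @^-1` B i))%E.

Definition standard_normal (R : realType) (d : measure_display)
    (T : measurableType d) (P : probability T R) (g : {RV P >-> R}) : Prop :=
  forall B : set R, measurable B -> distribution P g B = normal_prob 0 1 B.

(* X has the Bombieri Gaussian measure as its law.  The witnesses g are the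
   coefficients of X rescaled by 1 / sqrt (m! / alpha!), so asking for them on
   the probability space of X itself is no restriction on the law of X. *)
Definition bombieri_gaussian (R : realType) (d : measure_display)
    (T : measurableType d) (P : probability T R) (n m : nat)
    (X : T -> dhomog n R m) : Prop :=
  exists g : multi_index n m -> {RV P >-> R},
    [/\ mutual_independence g,
        forall a, standard_normal (g a) &
        forall w, X w = \sum_(a : multi_index n m)
          (Num.sqrt (multinomial_coef R a) * g a w) *:
            (mpolyX R (exponent a)) :> mpoly n R].

Definition cube_max (R : realType) (n m : nat) (p : dhomog n R m) : R :=
  sup [set `|meval x (mpoly_of_dhomog p)| | x in
        [set x : 'I_n -> R | forall i, -1 <= x i <= 1]].

Lemma continuous_meval (R : realType) (n : nat) (p : mpoly n R) :
  continuous (fun x : {ptws 'I_n -> R} => meval x p).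
Proof.
pose T := {ptws 'I_n -> R}.
have cP (s : seq 'I_n) (a : multinom n) :
    continuous (fun x : T => \prod_(i <- s) (x i ^+ a i) : R).
  elim: s => [|i s IH] x.
    have -> : (fun x : T => \prod_(i <- [::]) (x i ^+ a i) : R) = cst 1.
      by apply/funext => y; rewrite big_nil.
    exact: (@cst_continuous T R).
  have -> : (fun x : T => \prod_(i <- i :: s) (x i ^+ a i) : R) =
     (fun x : T => x i ^+ a i) \* (fun x : T => \prod_(i <- s) (x i ^+ a i)).
    by apply/funext => y; rewrite big_cons.
  apply: continuousM; last exact: IH.
  apply: (@continuous_comp _ _ _ (fun x : T => x i) (fun r : R => r ^+ a i)).
    exact: (@proj_continuous 'I_n (fun=> R) i).
  exact: exprn_continuous.
have cS (s : seq (multinom n)) :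
    continuous (fun x : T => \sum_(a <- s) mcoeff a p * \prod_(i < n) (x i ^+ a i) : R).
  elim: s => [|a s IH] x.
    have -> : (fun x : T => \sum_(a <- [::]) mcoeff a p * \prod_(i < n) (x i ^+ a i) : R) = cst 0.
      by apply/funext => y; rewrite big_nil.
    exact: (@cst_continuous T R).
  have -> : (fun x : T => \sum_(a <- a :: s) mcoeff a p * \prod_(i < n) (x i ^+ a i) : R) =
     (fun x : T => mcoeff a p * \prod_(i < n) (x i ^+ a i)) \+
     (fun x : T => \sum_(a <- s) mcoeff a p * \prod_(i < n) (x i ^+ a i)).
    by apply/funext => y; rewrite big_cons.
  apply: continuousD; last exact: IH.
  apply: continuousM; [exact: cst_continuous|exact: cP].
have -> : (fun x : T => meval x p) =
  fun x : T => \sum_(a <- msupp p) mcoeff a p * \prod_(i < n) (x i ^+ a i).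
  by apply/funext => y; rewrite mevalE.
exact: cS.
Qed.

Lemma cube_maxP (R : realType) (n m : nat) (p : dhomog n R m) :
  exists2 x : 'I_n -> R, (forall i, -1 <= x i <= 1) &
    cube_max p = `|meval x (mpoly_of_dhomog p)| /\
    forall y : 'I_n -> R, (forall i, -1 <= y i <= 1) ->
      `|meval y (mpoly_of_dhomog p)| <= cube_max p.
Proof.
set A := [set x : {ptws 'I_n -> R} | forall i, -1 <= x i <= 1].
have A0 : A !=set0 by exists (fun=> 0) => i; rewrite lerN10 ler01.
have cA : compact A.
  have := @tychonoff 'I_n (fun=> R) (fun=> `[-1, 1]%classic)
    (fun _ => @segment_compact _ _ _).
  congr compact; apply/seteqP; split=> x /= h i; have := h i; by rewrite /= in_itv.
have := @compact_EVT_max _ R (fun x : {ptws 'I_n -> R} => `|meval x (mpoly_of_dhomog p)|) A A0 cA.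
case.
  apply: continuous_subspaceT => x.
  apply: continuous_comp; first exact: continuous_meval.
  exact: norm_continuous.
move=> x /set_mem Ax h.
have e : cube_max p = `|meval x (mpoly_of_dhomog p)|.
  rewrite /cube_max; apply/eqP; rewrite eq_le; apply/andP; split.
    apply: ge_sup; first by case: A0 => z Az; eexists; exists z; first exact: Az.
    by move=> _ [y Ay <-]; apply: h; apply/mem_set.
  apply: ub_le_sup; last by exists x.
  by exists (`|meval x (mpoly_of_dhomog p)|) => _ [y Ay <-]; apply: h; apply/mem_set.
exists x => //; split=> // y Ay; rewrite e.
by apply: h; apply/mem_set.
Qed.

Definition vertex_max (R : realType) (n m : nat) (p : dhomog n R m) : R :=
  \big[Num.max/0]_(e : {ffun 'I_n -> bool})
    `|meval (fun i => (-1) ^+ e i) (mpoly_of_dhomog p)|.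

Definition bigO_in_probability (R : realType) (d : nat -> measure_display)
    (T : forall n, measurableType (d n))
    (P : forall n, probability (T n) R)
    (A : forall n, T n -> R) (a : nat -> R) : Prop :=
  forall eta : R, 0 < eta ->
    exists2 C : R, 0 < C &
      \forall n \near \oo, (P n [set w | (A n w > C * a n)%R] < eta%:E)%E.

(* Main.v *)
Require Import Defs.
From mathcomp Require Import all_boot all_order all_algebra.
From mathcomp Require Import all_classical all_reals all_analysis.
From mathcomp Require Import -(notations) mpoly.
From mathcomp Require Import measurable_realfun.
From mathcomp Require Import zify ring lra.

(* Split X = H + Q, where H collects the squarefree monomials.  H is affine in
   each variable, so on the cube it is largest at a vertex, and therefore
   M(X) <= V(X) + 2 sup |Q|.

   Only O(n^(m-1)) of the n^m terms of the variance belong to Q, and Q is the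
   diagonal restriction of a polynomial which is affine in each of nm variables
   and hence is largest at one of 2^(nm) points; the union bound gives
   sup |Q| = O(n^(m/2)) with high probability.

   For the lower bound V(X) >= c n^((m+1)/2), apply the second moment method to
   the partition function Z = sum_e exp (lam X(e)) over the vertices e.  Since
   X has covariance <x, y>^m, the ratio E Z^2 / (E Z)^2 is the mean of
   exp (lam^2 <e, f>^m), which is close to 1 when lam^2 is a small multiple of
   n^(1-m).  This needs m >= 2; for m = 1 one has Q = 0, and only V(X) > 0
   remains to be shown. *)

Set Implicit Arguments.
Unset Strict Implicit.
Unset Printing Implicit Defensive.

Import Order.TTheory GRing.Theory Num.Theory.
Import numFieldNormedType.Exports.

Local Open Scope classical_set_scope.
Local Open Scope ring_scope.

(** * Integration against a weighted law *)

Section weighted_law.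
Local Open Scope ereal_scope.
Context (R : realType) (d1 d2 : measure_display) (X : measurableType d1)
  (Y : measurableType d2).
Variables (mu : {measure set X -> \bar R}) (nu : {measure set Y -> \bar R}).
Variables (h : X -> R) (g : X -> Y) (k : R).
Hypotheses (mh : measurable_fun [set: X] h) (h0 : forall x, (0 <= h x)%R).
Hypothesis mg : measurable_fun [set: X] g.
Hypothesis law_g : forall B, measurable B ->
  \int[mu]_(x in g @^-1` B) (h x)%:E = k%:E * nu B.

Import HBNNSimple.

Let weighted_law_nnsfun (f : {nnsfun Y >-> R}) :
  \int[mu]_x ((h x)%:E * (f (g x))%:E) = k%:E * \int[nu]_y (f y)%:E.
Proof.
have m1 r : measurable_fun [set: X] (fun x => \1_(f @^-1` [set r]) (g x) : R).
  by apply: (@measurableT_comp _ _ _ _ _ _ (\1_(f @^-1` [set r]) : Y -> R)) => //.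
have -> : \int[nu]_y (f y)%:E =
    \sum_(r \in range f) (r%:E * nu (f @^-1` [set r])).
  under eq_integral do rewrite fimfunE -fsumEFin//.
  rewrite ge0_integral_fsum//; last 2 first.
  - by move=> r; exact/measurable_EFinP/measurable_funM.
  - by move=> r x _; rewrite nnfun_muleindic_ge0.
  apply: eq_fsbigr => r _; rewrite integralZl_indic_nnsfun//.
  by rewrite integral_indic// setIT.
transitivity (\int[mu]_x \sum_(r \in range f)
    ((h x)%:E * (r * \1_(f @^-1` [set r]) (g x))%:E)).
  apply: eq_integral => x _; rewrite fimfunE -fsumEFin// ge0_mule_fsumr// => r.
  by rewrite EFinM nnfun_muleindic_ge0.
rewrite ge0_integral_fsum//; last 2 first.
- move=> r; apply: emeasurable_funM; first exact/measurable_EFinP.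
  by apply/measurable_EFinP/measurable_funM => //; exact: m1.
- by move=> r x _; rewrite mule_ge0 ?(EFinM r) ?nnfun_muleindic_ge0// lee_fin.
rewrite ge0_mule_fsumr; last first.
  move=> r; have [r0|r0] := ltP r 0%R; last by rewrite mule_ge0 ?lee_fin ?measure_ge0.
  by rewrite preimage_nnfun0// measure0 mule0.
apply: eq_fsbigr => r /[!inE] -[y _ fy].
have r0 : (0 <= r)%R by rewrite -fy.
rewrite [RHS]muleCA -law_g; last exact: measurable_funPTI.
transitivity (\int[mu]_x (r%:E * ((h x)%:E * (\1_(f @^-1` [set r]) (g x))%:E))).
  by apply: eq_integral => x _; rewrite EFinM muleCA.
rewrite ge0_integralZl//; first last.
- by move=> x _; rewrite mule_ge0 ?lee_fin.
- apply: emeasurable_funM; first exact/measurable_EFinP.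
  by apply/measurable_EFinP; exact: m1.
congr (_ * _); rewrite [RHS]integral_mkcond.
by apply: eq_integral => x _; rewrite epatch_indic.
Qed.

(** By [law_g], the image under [g] of the measure with density [h] is [k] times [nu]. This is used
    with [g] the identity and [h] a normal density, then with [h] a function of variables
    independent of [g]. Simple functions come first, and monotone convergence does the rest. *)
Lemma ge0_integral_weighted_law (f : Y -> R) :
    measurable_fun [set: Y] f -> (forall y, (0 <= f y)%R) ->
  \int[mu]_x ((h x)%:E * (f (g x))%:E) = k%:E * \int[nu]_y (f y)%:E.
Proof.
move=> mf f0; have mfE : measurable_fun [set: Y] (EFin \o f).
  exact/measurable_EFinP.
pose f_ := nnsfun_approx measurableT mfE.
have f_cvg y : (f_ n y)%:E @[n --> \oo] --> (f y)%:E.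
  by apply: (@cvg_nnsfun_approx _ _ _ _ measurableT _ mfE) => // x _ /=; rewrite lee_fin.
have f_nd y : {homo (fun n => (f_ n y)%:E) : n m / (n <= m)%N >-> n <= m}.
  by move=> m n mn; rewrite lee_fin; exact/lefP/nd_nnsfun_approx.
have c1 : \int[nu]_y (f_ n y)%:E @[n --> \oo] --> \int[nu]_y (f y)%:E.
  rewrite (_ : \int[nu]_y _ = \int[nu]_y limn (fun n => (f_ n y)%:E)).
    apply: cvg_monotone_convergence => //; last by move=> n y _; rewrite lee_fin.
    by move=> n; exact/measurable_EFinP.
  by apply: eq_integral => y _; apply/esym/cvg_lim.
have c2 : \int[mu]_x ((h x)%:E * (f_ n (g x))%:E) @[n --> \oo] -->
    \int[mu]_x ((h x)%:E * (f (g x))%:E).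
  rewrite (_ : \int[mu]_x _ =
    \int[mu]_x limn (fun n => (h x)%:E * (f_ n (g x))%:E)).
    apply: cvg_monotone_convergence => //.
    - move=> n; apply: emeasurable_funM; first exact/measurable_EFinP.
      by apply/measurable_EFinP/measurableT_comp.
    - by move=> n x _; rewrite mule_ge0// lee_fin.
    - by move=> x _ m n mn; rewrite lee_wpmul2l ?lee_fin//; exact: f_nd.
  apply: eq_integral => x _; apply/esym/cvg_lim => //.
  by apply: cvgeZl => //; exact: f_cvg.
apply: (cvg_unique _ c2) => //.
rewrite (_ : (fun n => _) = (fun n => k%:E * \int[nu]_y (f_ n y)%:E)); last first.
  by apply/funext => n; exact: weighted_law_nnsfun.
exact: cvgeZl.
Qed.

End weighted_law.

(** * Exponential moments of a single Gaussian *)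

Section normal_mgf.
Variable R : realType.

Lemma ge0_integral_normal_prob (m s : R) (f : R -> R) :
    measurable_fun [set: R] f -> (forall x, 0 <= f x) ->
  (\int[normal_prob m s]_x (f x)%:E =
   \int[lebesgue_measure]_x (normal_pdf m s x * f x)%:E)%E.
Proof.
move=> mf f0; have h := @ge0_integral_weighted_law R _ _ _ _
  (@lebesgue_measure R) (normal_prob m s) (normal_pdf m s) id 1
  (measurable_normal_pdf m s) (normal_pdf_ge0 m s) (@measurable_id _ _ _).
by rewrite -[LHS]mul1e -h// => B mB; rewrite mul1e.
Qed.

(** Completing the square: [exp (c x)] times the standard density is [exp (c^2 / 2)] times the
    normal density centred at [c]. *)
Lemma normal_prob_mgf (c : R) :
  (\int[normal_prob 0 1]_x (expR (c * x))%:E = (expR (c ^+ 2 / 2))%:E)%E.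
Proof.
rewrite ge0_integral_normal_prob//; last first.
  by apply: measurableT_comp => //; exact: measurable_funM.
transitivity (\int[lebesgue_measure]_x
    ((expR (c ^+ 2 / 2))%:E * (normal_pdf c 1 x)%:E))%E.
  apply: eq_integral => x _; rewrite -EFinM; congr EFin.
  rewrite !normal_pdfE ?oner_eq0//= /normal_fun [RHS]mulrCA -mulrA -!expRD.
  by congr (_ * expR _); field.
rewrite ge0_integralZl ?lee_fin ?expR_ge0//; last 2 first.
- by apply/measurable_EFinP; apply: measurable_normal_pdf.
- by move=> x _; rewrite lee_fin normal_pdf_ge0.
by rewrite integral_normal_pdf mule1.
Qed.

(** Since [3/8 - 1/2 = - 1/8], the integrand against Lebesgue measure is exactly twice the centred
    normal density of standard deviation 2. *)
Lemma normal_prob_exp_sqr :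
  (\int[normal_prob 0 1]_x (expR (3 / 8 * x ^+ 2))%:E = (2 : R)%:E)%E.
Proof.
rewrite ge0_integral_normal_prob//; last first.
  by apply: measurableT_comp => //; exact: measurable_funM.
transitivity (\int[lebesgue_measure]_x
    ((2 : R)%:E * (normal_pdf 0 2 x)%:E))%E.
  apply: eq_integral => x _; rewrite -EFinM; congr EFin.
  rewrite !normal_pdfE ?oner_eq0 ?pnatr_eq0//= /normal_fun [RHS]mulrA -[LHS]mulrA -expRD.
  congr (_ * expR _); last by field.
  rewrite /normal_peak expr1n mul1r -mulrnAr sqrtrM ?sqr_ge0//.
  by rewrite sqrtr_sqr ger0_norm// invfM mulrA divff// mul1r.
rewrite ge0_integralZl ?lee_fin ?expR_ge0//; last 2 first.
- by apply/measurable_EFinP; apply: measurable_normal_pdf.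
- by move=> x _; rewrite lee_fin normal_pdf_ge0.
by rewrite integral_normal_pdf mule1.
Qed.

End normal_mgf.

(** * Exponential moments of independent Gaussians *)

Section gaussian_family.
Context (R : realType) (d : measure_display) (T : measurableType d)
  (P : probability T R) (I : finType) (g : I -> {RV P >-> R}).
Hypotheses (indep_g : mutual_independence g)
  (normal_g : forall i, standard_normal (g i)).

Let cylinder (J : {set I}) (B : I -> set R) :=
  \bigcap_(i in [set` J]) (g i @^-1` B i).

Let measurable_cylinder J B :
  (forall i, measurable (B i)) -> measurable (cylinder J B).
Proof.
move=> mB; apply: fin_bigcap_measurable; first exact: finite_finset.
by move=> i _; exact: measurable_funPTI.
Qed.

Let measurable_expg c i :
  measurable_fun [set: T] (fun w => expR (c * g i w)).
Proof. by apply: measurableT_comp => //; exact: measurable_funM. Qed.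

(** Independence is given for events only, so the exponentials are integrated out one at a time. The
    cylinder keeps the induction going: testing [g i] against a set [B0] just adds the index [i] to
    the cylinder. *)
Let integral_prod_expR (c : I -> R) (s : seq I) : uniq s ->
    forall (J : {set I}) B, (forall i, measurable (B i)) ->
    (forall i, i \in s -> i \notin J) ->
  (\int[P]_w (\prod_(i <- s) expR (c i * g i w) * \1_(cylinder J B) w)%:E =
   (\prod_(i <- s) expR (c i ^+ 2 / 2))%:E * P (cylinder J B))%E.
Proof.
elim: s => [_ J B mB _|i s IH /= /andP[iNs us] J B mB sJ].
  under eq_integral do rewrite big_nil mul1r.
  by rewrite big_nil mul1e integral_indic ?setIT//; exact: measurable_cylinder.
have sJ' j : j \in s -> j \notin J by move=> js; rewrite sJ// inE js orbT.
have iJ : i \notin J by rewrite sJ// mem_head.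
pose h w := \prod_(j <- s) expR (c j * g j w) * \1_(cylinder J B) w.
pose k := \prod_(j <- s) expR (c j ^+ 2 / 2) * fine (P (cylinder J B)).
have mh : measurable_fun [set: T] h.
  apply: measurable_funM; first exact: measurable_prod.
  exact/measurable_indic/measurable_cylinder.
have h0 w : 0 <= h w.
  by rewrite mulr_ge0// prodr_ge0// => j _; exact: expR_ge0.
(* Under the weight [h], made of the remaining factors, [g i] still has a multiple of the normal
   law; this is the induction hypothesis for the cylinder over [i |: J]. *)
have law B0 : measurable B0 ->
    (\int[P]_(w in g i @^-1` B0) (h w)%:E = k%:E * normal_prob 0 1 B0)%E.
  move=> mB0; pose B' j := if j == i then B0 else B j.
  have mB' j : measurable (B' j) by rewrite /B'; case: ifP.
  have sJi j : j \in s -> j \notin i |: J.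
    move=> js; rewrite !inE negb_or sJ'// andbT.
    by apply: contraNneq iNs => <-.
  have BB' j : j \in J -> B' j = B j.
    by rewrite /B'; case: eqP => // ->; rewrite (negPf iJ).
  have cE : cylinder (i |: J) B' = cylinder J B `&` g i @^-1` B0.
    apply/seteqP; split=> [w Dw|w [Dw gw] j].
      split=> [j jJ|]; last first.
        by have := Dw i; rewrite /B' eqxx; apply; rewrite /= !inE eqxx.
      by rewrite -BB'//; apply: Dw; rewrite /= !inE jJ orbT.
    rewrite /= !inE => /predU1P[->|jJ]; first by rewrite /B' eqxx.
    by rewrite /preimage/= BB'//; exact: Dw.
  transitivity (\int[P]_w (\prod_(j <- s) expR (c j * g j w) *
      \1_(cylinder (i |: J) B') w)%:E)%E.
    rewrite integral_mkcond; apply: eq_integral => w _.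
    by rewrite epatch_indic/= cE indicI -EFinM -mulrA.
  rewrite IH// /k EFinM -muleA fineK; last first.
    by apply: fin_num_measure; exact: measurable_cylinder.
  congr (_ * _)%E; rewrite indep_g// big_setU1//= muleC.
  rewrite indep_g//; congr (_ * _)%E; last by rewrite /B' eqxx; exact: normal_g.
  by apply: eq_bigr => j jJ; rewrite BB'.
rewrite big_cons; transitivity (\int[P]_w ((h w)%:E *
    (expR (c i * g i w))%:E))%E.
  apply: eq_integral => w _; rewrite big_cons -EFinM /h; congr EFin.
  by ring.
have mgi : measurable_fun [set: T] (g i) by [].
rewrite (@ge0_integral_weighted_law R _ _ _ _ P (normal_prob 0 1) h (g i) k mh h0 mgi law
  (fun x => expR (c i * x)))//; last first.
  by apply: measurableT_comp => //; exact: measurable_funM.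
transitivity (k%:E * (expR (c i ^+ 2 / 2))%:E)%E.
  by congr (_ * _)%E; exact: normal_prob_mgf.
rewrite /k EFinM fineK; last first.
  by apply: fin_num_measure; exact: measurable_cylinder.
by rewrite [in RHS]EFinM -[RHS]muleA muleC.
Qed.

Lemma gaussian_mgf (c : I -> R) :
  (\int[P]_w (expR (\sum_i c i * g i w))%:E =
   (expR ((\sum_i c i ^+ 2) / 2))%:E)%E.
Proof.
have := @integral_prod_expR c (index_enum I) (index_enum_uniq I) finset.set0
  (fun=> setT) (fun=> measurableT).
have -> : cylinder finset.set0 (fun=> setT) = setT.
  by apply/seteqP; split=> // w _ i; rewrite /= inE.
rewrite probability_setT mule1 -expR_sum mulr_suml => <-.
  apply: eq_integral => w _; rewrite indicT mulr1; congr EFin.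
  by rewrite expR_sum.
by move=> i _; rewrite inE.
Qed.

Let Y (c : I -> R) w := \sum_i c i * g i w.

Let measurable_Y c : measurable_fun [set: T] (Y c).
Proof. by apply: measurable_sum => i; exact: measurable_funM. Qed.

Let measurable_gtY c t : measurable [set w | t < Y c w].
Proof.
have -> : [set w | t < Y c w] = Y c @^-1` `]t, +oo[.
  by apply/seteqP; split=> w; rewrite /= in_itv/= andbT.
by rewrite -[X in measurable X]setTI; exact: measurable_Y.
Qed.

Let measurable_sum_expR (V : finType) (c : V -> I -> R) (a b : R) :
  measurable_fun [set: T] (fun w => b * \sum_v expR (Y (c v) w - a)).
Proof.
apply: measurable_funM => //; apply: measurable_sum => v.
by apply: measurableT_comp => //; exact: measurable_funB.
Qed.

Let integral_sum_expR (V : finType) (c : V -> I -> R) (a b : R) : 0 <= b ->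
  (\int[P]_w (b * \sum_v expR (Y (c v) w - a))%:E =
   (b * \sum_v expR ((\sum_i c v i ^+ 2) / 2 - a))%:E)%E.
Proof.
move=> b0; have me v : measurable_fun [set: T] (fun w => (expR (Y (c v) w))%:E).
  by apply/measurable_EFinP; apply: measurableT_comp => //.
transitivity (\int[P]_w \sum_v ((b * expR (- a))%:E * (expR (Y (c v) w))%:E))%E.
  apply: eq_integral => w _; rewrite mulr_sumr -sumEFin.
  by apply: eq_bigr => v _; rewrite -EFinM expRD; congr EFin; ring.
rewrite ge0_integral_sum//; first last.
- by move=> v w _; rewrite -EFinM lee_fin !mulr_ge0// expR_ge0.
- by move=> v; exact: measurable_funeM.
rewrite mulr_sumr -sumEFin; apply: eq_bigr => v _.
rewrite ge0_integralZl ?lee_fin ?mulr_ge0 ?expR_ge0//.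
by rewrite gaussian_mgf -EFinM expRD; congr EFin; ring.
Qed.

(* Chernoff: the indicator of the event is at most the sum of the
   exp (Y u - t). *)
Lemma gaussian_max_tail (U : finType) (c : U -> I -> R) (s t : R) :
    (forall u, \sum_i c u i ^+ 2 <= s) ->
  exists A : set T, [/\ measurable A,
    (P A <= (#|U|%:R * expR (s / 2 - t))%:E)%E &
    forall w, ~ A w -> forall u, \sum_i c u i * g i w <= t].
Proof.
move=> cs; pose A := \bigcup_(u in [set: U]) [set w | t < Y (c u) w].
have mA : measurable A.
  by apply: fin_bigcup_measurable => // u _; exact: measurable_gtY.
exists A; split=> //; last first.
  by move=> w nAw u; rewrite leNgt; apply/negP => tu; apply: nAw; exists u.
apply: (@le_trans _ _ (\int[P]_w (1 * \sum_u expR (Y (c u) w - t))%:E)%E).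
  have -> : P A = (\int[P]_w (\1_A w)%:E)%E by rewrite integral_indic// setIT.
  apply: ge0_le_integral => //.
  - exact/measurable_EFinP/measurable_indic.
  - exact/measurable_EFinP/measurable_sum_expR.
  move=> w _; rewrite lee_fin mul1r indicE; case: (boolP (w \in A)) => [|_].
    rewrite inE => -[u _ /= tu]; rewrite (bigD1 u)//= -[leLHS]addr0 lerD//.
      by rewrite -[leLHS]expR0 ler_expR subr_ge0 ltW.
    by rewrite sumr_ge0// => v _; exact: expR_ge0.
  by rewrite sumr_ge0// => u _; exact: expR_ge0.
rewrite integral_sum_expR// lee_fin mul1r mulr_natl -sumr_const.
by apply: ler_sum => u _; rewrite ler_expR lerD2r ler_pM2r.
Qed.

(** The normalized partition function [Z], the average of the [exp (Y u - s / 2)], has mean 1 and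
    second moment at most [1 + k]. If every [Y u] is at most [s / 2 - ln 2], then [Z <= 1/2], which
    by Chebyshev has probability at most [4 k]. *)
Lemma gaussian_max_second_moment (U : finType) (c : U -> I -> R) (s k : R) :
    (0 < #|U|)%N -> (forall u, \sum_i c u i ^+ 2 = s) ->
    \sum_u \sum_v expR (\sum_i c u i * c v i) <= #|U|%:R ^+ 2 * (1 + k) ->
  exists A : set T, [/\ measurable A, (P A <= (4 * k)%:E)%E &
    forall w, ~ A w -> exists u, s / 2 - ln 2 < \sum_i c u i * g i w].
Proof.
move=> U0 cs ck; pose N : R := #|U|%:R; have N0 : 0 < N by rewrite ltr0n.
pose A := \bigcap_(u in [set: U]) ~` [set w | s / 2 - ln 2 < Y (c u) w].
have mA : measurable A.
  apply: fin_bigcap_measurable; first exact: finite_finset.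
  by move=> u _; exact/measurableC/measurable_gtY.
exists A; split=> //; last first.
  by move=> w; rewrite -existsNP => -[u /not_implyP[_ /contrapT]]; exists u.
pose Z w := N^-1 * \sum_u expR (Y (c u) w - s / 2).
pose cc (p : U * U) i := c p.1 i + c p.2 i.
have ZZ w : Z w ^+ 2 = N ^- 2 * \sum_p expR (Y (cc p) w - s).
  rewrite /Z exprMn exprVn; congr (_ * _).
  rewrite expr2 big_distrlr/= pair_bigA/=; apply: eq_bigr => -[u v] _ /=.
  rewrite -expRD; congr expR; rewrite /Y /cc /=.
  under [in RHS]eq_bigr do rewrite mulrDl.
  by rewrite big_split/=; field.
have mZ : measurable_fun [set: T] Z by exact: measurable_sum_expR.
have Z0 w : 0 <= Z w.
  by apply: mulr_ge0; [rewrite invr_ge0 ltW|apply: sumr_ge0 => u _; exact: expR_ge0].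
have iZ : (\int[P]_w (Z w)%:E = 1)%E.
  rewrite integral_sum_expR ?invr_ge0 ?ltW//.
  under eq_bigr do rewrite cs subrr expR0.
  by rewrite sumr_const mulVf// gt_eqF.
have iZZ : (\int[P]_w (Z w ^+ 2)%:E <= (1 + k)%:E)%E.
  under eq_integral do rewrite ZZ.
  have N20 : 0 <= N ^- 2 by rewrite invr_ge0 exprn_ge0// ltW.
  rewrite integral_sum_expR// lee_fin.
  rewrite ler_pdivrMl ?exprn_gt0//; apply: le_trans ck.
  rewrite pair_bigA/=; apply: ler_sum => -[u v] _ /=; rewrite ler_expR /cc/=.
  (* Both vectors have squared norm [s], so after halving and subtracting [s] only the inner product
     is left in the exponent. *)
  have -> : \sum_i (c u i + c v i) ^+ 2 =
      s + s + 2 * \sum_i c u i * c v i.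
    rewrite -{1}(cs u) -(cs v) mulr_sumr -!big_split/=; apply: eq_bigr => i _.
    by ring.
  by rewrite le_eqVlt; apply/orP; left; apply/eqP; field.
(* Integrates [1_A <= 4 (Z - 1)^2], with [8 Z] moved to the left so that no subtraction occurs
   between extended reals. *)
have key : (P A + 8%:E <= (8 + 4 * k)%:E)%E.
  have -> : P A = (\int[P]_w (\1_A w)%:E)%E by rewrite integral_indic// setIT.
  have -> : (8%:E = \int[P]_w (8 * Z w)%:E)%E.
    under eq_integral do rewrite EFinM.
    rewrite ge0_integralZl ?iZ ?mule1//; first exact/measurable_EFinP.
    by move=> w _; rewrite lee_fin.
  rewrite -ge0_integralD//; first last.
  - exact/measurable_EFinP/measurable_funM.
  - by move=> w _; rewrite lee_fin mulr_ge0.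
  - exact/measurable_EFinP/measurable_indic.
  apply: (@le_trans _ _ (\int[P]_w (4%:E * (Z w ^+ 2)%:E + 4%:E))%E).
    apply: ge0_le_integral => //.
    - by move=> w _; rewrite adde_ge0// lee_fin mulr_ge0.
    - apply: emeasurable_funD; first exact/measurable_EFinP/measurable_indic.
      exact/measurable_EFinP/measurable_funM.
    - apply: emeasurable_funD => //; apply: measurable_funeM.
      exact/measurable_EFinP/measurable_funX.
    move=> w _; rewrite -!EFinM -!EFinD lee_fin indicE.
    case: (boolP (w \in A)) => [|_] /=; last first.
      by have := sqr_ge0 (Z w - 1); rewrite mulr0n add0r; nra.
    rewrite inE => Aw; have : Z w <= 2^-1; last by have := Z0 w; rewrite mulr1n; nra.
    rewrite /Z ler_pdivrMl//.
    have -> : N * 2^-1 = \sum_(u : U) 2^-1 by rewrite sumr_const mulr_natl.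
    apply: ler_sum => u _; rewrite -[leRHS]lnK ?posrE// ler_expR lnV ?posrE//.
    by have /= /negP := Aw u Logic.I; rewrite -leNgt lerBlDr addrC.
  rewrite ge0_integralD//; first last.
  - apply: measurable_funeM; exact/measurable_EFinP/measurable_funX.
  - by move=> w _; rewrite mule_ge0// lee_fin exprn_ge0.
  have -> : (\int[P]__ 4%:E = 4%:E :> \bar R)%E.
    by rewrite -[RHS]mule1 -(@probability_setT _ _ _ P) -integral_cst.
  rewrite ge0_integralZl//; first last.
  - by move=> w _; rewrite lee_fin exprn_ge0.
  - exact/measurable_EFinP/measurable_funX.
  apply: (@le_trans _ _ (4%:E * (1 + k)%:E + 4%:E)%E).
    by apply: leeD2r; apply: lee_wpmul2l.
  by rewrite -EFinM -!EFinD lee_fin; lra.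
have := key; rewrite -[P A]fineK; last exact: fin_num_measure.
by rewrite -!EFinD !lee_fin; lra.
Qed.

End gaussian_family.

(** * Multinomial coefficients *)

Section multinomial.
Variables (R : realType) (n : nat).
Implicit Types (x : 'I_n -> R) (a : multinom n).

Let fact_prod a : nat := \prod_(i < n) (a i)`!.

Let fact_prod_gt0 a : (0 < fact_prod a)%N.
Proof. by apply: prodn_gt0 => i; exact: fact_gt0. Qed.

Let sumX : mpoly n R := \sum_(i < n) mpolyX R (mnm1 i).

Let mnm1K i a : (0 < a i)%N -> mnm_add (mnm1 i) (mnm_sub a (mnm1 i)) = a.
Proof.
move=> ai; apply/mnmP => j; rewrite mnmDE mnmBE mnm1E.
by case: eqP => [<-|_]; rewrite ?subn0// subnKC.
Qed.

Let mcoeffXU_mul (p : mpoly n R) i a :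
  mcoeff a (p * mpolyX R (mnm1 i)) =
  if (0 < a i)%N then mcoeff (mnm_sub a (mnm1 i)) p else 0.
Proof.
case: ifPn => ai; first by rewrite -{1}(mnm1K ai) mcoeffMX.
apply/eqP; apply: contraNT ai; rewrite -mcoeff_msupp (perm_mem (msuppMX _ _)).
by case/mapP => b _ ->; rewrite mnmDE mnm1E eqxx.
Qed.

(** The multinomial theorem on coefficients, by induction on [m]. The last factor contributes some
    variable [i], and [a! = a_i (a - e_i)!] turns the sum over [i] into [m!] times the sum of the
    [a_i], that is [(m + 1)!]. *)
Let mcoeff_sumX m a : mcoeff a (sumX ^+ m) * (fact_prod a)%:R =
  if mdeg a == m then m`!%:R else 0.
Proof.
elim: m a => [|m IH] a.
  rewrite expr0 mcoeff1 -mdeg_eq0; case: eqP; last by rewrite mul0r.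
  move/eqP; rewrite mdeg_eq0 => /eqP ->; rewrite mul1r /fact_prod big1// => i _.
  by rewrite mnm0E fact0.
rewrite exprSr mulr_sumr raddf_sum mulr_suml /=.
rewrite (eq_bigr (fun i => (a i)%:R * (if mdeg a == m.+1 then m`!%:R else 0))).
  rewrite -mulr_suml -natr_sum -mdegE; case: eqP => [->|_]; last by rewrite mulr0.
  by rewrite -natrM -factS.
move=> i _; rewrite mcoeffXU_mul; case: ifPn; last first.
  by rewrite -eqn0Ngt => /eqP ->; rewrite !mul0r.
move=> ai; have -> : (mdeg a == m.+1) = (mdeg (mnm_sub a (mnm1 i)) == m).
  by rewrite -{1}(mnm1K ai) mdegD mdeg1 add1n eqSS.
rewrite -IH mulrCA; congr (_ * _); rewrite -natrM; congr (_%:R).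
rewrite /fact_prod (bigD1 i)//= [in RHS](bigD1 i)//= mulnA mnmBE mnm1E eqxx.
congr (_ * _)%N; first by case: (a i) ai => // k _; rewrite subn1 factS.
by apply: eq_bigr => j ji; rewrite mnmBE mnm1E eq_sym (negPf ji) subn0.
Qed.

Lemma meval_multi_index m (p : mpoly n R) x :
    (forall a, mcoeff a p != 0 -> mdeg a = m) ->
  meval x p = \sum_(a : multi_index n m)
    mcoeff (exponent a) p * \prod_(i < n) x i ^+ exponent a i.
Proof.
move=> pm; rewrite {1}(@mpolywE _ _ m.+1 p); last first.
  rewrite msizeE; apply/bigmax_leqP_seq => a; rewrite mcoeff_msupp => /pm -> _.
  by [].
rewrite raddf_sum /= (bigID (fun a : bmultinom n m.+1 => mdeg (bmnm a) == m))/=.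
rewrite [X in _ + X]big1 ?addr0; last first.
  move=> a am; rewrite mevalZ; have [/pm E|/negPn/eqP ->] := boolP (mcoeff a p != 0).
    by rewrite E eqxx in am.
  by rewrite mul0r.
rewrite (big_sub (fun a : bmultinom n m.+1 => mdeg (bmnm a) == m))/=.
by apply: eq_bigr => a _; rewrite mevalZ mevalX.
Qed.

(** With products [y_i z_i] in place of the [x_i], this computes the covariance [<y, z>^m] of the
    random polynomial; with all [x_i = 1], it gives the total variance [n^m]. *)
Lemma sum_multinomial_coef m x :
  \sum_(a : multi_index n m) multinomial_coef R a *
    \prod_(i < n) x i ^+ exponent a i = (\sum_(i < n) x i) ^+ m.
Proof.
have E a : mcoeff a (sumX ^+ m) =
    if mdeg a == m then m`!%:R / (fact_prod a)%:R else 0.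
  have f0 : (fact_prod a)%:R != 0 :> R by rewrite pnatr_eq0 -lt0n.
  by apply: (mulIf f0); rewrite mcoeff_sumX; case: ifP; rewrite ?mul0r// divfK.
have := @meval_multi_index m (sumX ^+ m) x; rewrite rmorphXn/= raddf_sum /=.
under eq_bigr do rewrite mevalXU.
move=> ->; last first.
  by move=> a; rewrite E; case: (mdeg a =P m) => // _; rewrite eqxx.
by apply: eq_bigr => a _; rewrite E (valP a).
Qed.

Definition squarefree m (b : multi_index n m) :=
  [forall i, (exponent b i <= 1)%N].

(** Both sides are the value at [(1, ..., 1)] of the elementary symmetric polynomial of degree [m],
    whose monomials are exactly the squarefree ones. *)
Lemma card_squarefree m :
  #|[pred b : multi_index n m | squarefree b]|%N = 'C(n, m).
Proof.
apply/eqP; rewrite -(eqr_nat R).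
have <- : meval (fun=> 1 : R) (mesym n R m) = 'C(n, m)%:R.
  rewrite mesymE raddf_sum /= (eq_bigr (fun=> 1)); last first.
    by move=> h _; rewrite mevalX big1// => i _; rewrite expr1n.
  by rewrite sumr_const -[in RHS](card_ord n) -card_draws cardsE.
rewrite (@meval_multi_index m); last first.
  move=> a; rewrite mcoeff_mesym /mechar.
  by case: (mdeg a =P m) => //=; rewrite eqxx.
apply/eqP; rewrite -sum1_card natr_sum big_mkcond/=.
apply: eq_bigr => a _; rewrite inE big1 ?mulr1; last by move=> i _; rewrite expr1n.
rewrite mcoeff_mesym /mechar (valP a)/= /squarefree.
by case: [forall _, _].
Qed.

(** Each squarefree index has coefficient [m!], so together they contribute the falling factorial
    [n (n - 1) ... (n - m + 1)] to the total [n^m]. The difference is bounded by induction on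
    [m]. *)
Lemma sum_multinomial_coef_not_squarefree m : (0 < m)%N ->
  \sum_(a : multi_index n m | ~~ squarefree a) multinomial_coef R a <=
  m%:R ^+ 2 * n%:R ^+ m.-1.
Proof.
move=> m0; have := sum_multinomial_coef m (fun=> 1).
rewrite sumr_const card_ord.
rewrite (eq_bigr (@multinomial_coef R n m)); last first.
  by move=> a _; rewrite big1 ?mulr1// => i _; rewrite expr1n.
rewrite (bigID (@squarefree m))/=.
rewrite (eq_bigr (fun=> m`!%:R)); last first.
  move=> a /forallP sa; rewrite /multinomial_coef big1 ?divr1// => i _.
  by have := sa i; case: (exponent a i) => [|[|]].
rewrite sumr_const card_squarefree -mulrnA mulnC bin_ffact => E.
suff: (n ^ m <= n ^_ m + m ^ 2 * n ^ m.-1)%N.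
  by rewrite -(ler_nat R) natrD natrM !natrX -E lerD2l.
elim: {E} m m0 => // -[|m] IH _; first by rewrite ffactn1 expn1 leq_addr.
have fl : (n ^_ m.+1 <= n ^ m.+1)%N.
  rewrite ffact_prod -[X in (_ <= _ ^ X)%N](card_ord m.+1) -prod_nat_const.
  by apply: leq_prod => i _; exact: leq_subr.
have {}IH := leq_mul (leqnn n) (IH isT).
(* The subtraction may be truncated, but [n <= (n - m.+1) + m.+1] holds in all cases. *)
have nF : (n * n ^_ m.+1 <= n ^_ m.+1 * (n - m.+1) + m.+1 * n ^_ m.+1)%N.
  by rewrite mulnC [X in (_ + X)%N]mulnC -mulnDr leq_mul2l; lia.
rewrite [X in (X <= _)%N]expnS ffactnSr; move: IH fl nF; rewrite /= !expnS.
set q := (n ^ m)%N; set F := (n ^_ m.+1)%N; set G := (F * _)%N.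
by rewrite !expn0; nia.
Qed.

End multinomial.

(** * Maxima over the cube and Rademacher sums *)

Definition upd (I : eqType) (A : Type) (x : I -> A) (i : I) (r : A) : I -> A :=
  fun j => if j == i then r else x j.

(** One pass over the coordinates: [S] is the invariant and [Q] what each coordinate attains. It
    serves to move a point of the cube to a vertex, and later to a rational point. *)
Lemma coordinatewise (I : finType) (A : Type) (Q : I -> A -> Prop)
    (S : (I -> A) -> Prop) (x : I -> A) :
    (forall y i, S y -> exists2 r, Q i r & S (upd y i r)) -> S x ->
  exists2 y, S y & forall i, Q i (y i).
Proof.
move=> step Sx.
suff [y Sy Qy] : exists2 y, S y & forall i, i \in enum I -> Q i (y i).
  by exists y => // i; apply: Qy; rewrite mem_enum.
elim: (enum I) => [|i s [y Sy Qy]]; first by exists x.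
have [r Qr Sr] := step y i Sy; exists (upd y i r) => // j.
rewrite inE /upd; case: eqP => [-> //|_ /=]; exact: Qy.
Qed.

(* A polynomial all of whose monomials are squarefree is affine in each
   variable, so moving the coordinates one by one to a well-chosen end of
   [-1, 1] does not decrease its absolute value. *)
Lemma squarefree_le_vertex (R : realType) (I J : finType) (c : J -> R)
    (S : J -> {set I}) (x : I -> R) : (forall i, -1 <= x i <= 1) ->
  exists e : {ffun I -> bool},
    `|\sum_j c j * \prod_(i in S j) x i| <=
    `|\sum_j c j * \prod_(i in S j) (-1) ^+ e i|.
Proof.
move=> x1; pose f (y : I -> R) := \sum_j c j * \prod_(i in S j) y i.
have [y [_ fy] y1] : exists2 y : I -> R,
    (forall i, -1 <= y i <= 1) /\ `|f x| <= `|f y| &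
    forall i, y i = 1 \/ y i = -1.
  apply: (@coordinatewise I R (fun _ r => r = 1 \/ r = -1) _ x) => //.
  move=> y i [y1 fy].
  pose a := \sum_(j | i \notin S j) c j * \prod_(k in S j) y k.
  pose b := \sum_(j | i \in S j) c j * \prod_(k in S j | k != i) y k.
  have fE r : f (upd y i r) = a + b * r.
    rewrite /f (bigID (fun j => i \in S j))/= addrC; congr (_ + _).
      apply: eq_bigr => j ij; congr (_ * _); apply: eq_bigr => k kj.
      by rewrite /upd; case: eqP kj ij => // ->  ->.
    rewrite /b mulr_suml; apply: eq_bigr => j ij; rewrite (bigD1 i)//=.
    rewrite {1}/upd eqxx -mulrA [r * _]mulrC; congr (_ * (_ * _)).
    by apply: eq_bigr => k /andP[_ /negPf ki]; rewrite /upd ki.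
  have fyE : f y = a + b * y i.
    rewrite -fE; congr f; apply/funext => k; rewrite /upd.
    by case: eqP => // ->.
  have cube r : -1 <= r <= 1 -> forall k, -1 <= upd y i r k <= 1.
    by move=> r1 k; rewrite /upd; case: ifP.
  have [/andP[yl yu] ] := (y1 i).
  suff [h|h] : `|f y| <= `|f (upd y i 1)| \/ `|f y| <= `|f (upd y i (-1))|.
  - exists 1; first by left.
    by split; [apply: cube; lra|exact: le_trans h].
  - exists (-1); first by right.
    by split; [apply: cube; lra|exact: le_trans h].
  rewrite !fE fyE mulr1 mulrN1.
  have b0 : 0 <= (1 - y i) * (1 + y i) * b ^+ 2.
    by rewrite mulr_ge0 ?sqr_ge0// mulr_ge0; lra.
  (* The sign of [a b] selects the end: for [a b >= 0], the difference [(a + b)^2 - (a + b y)^2] is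
     [2 a b (1 - y) + b^2 (1 - y^2)], and the other case is symmetric. *)
  have [ab|ab] := leP 0 (a * b); [left|right];
    rewrite -ler_sqr ?nnegrE// !real_normK ?num_real//.
    by have : 0 <= (1 - y i) * (a * b); [rewrite mulr_ge0//; lra|nra].
  by have : 0 <= (1 + y i) * - (a * b); [rewrite mulr_ge0//; lra|nra].
exists [ffun i => y i == -1]; apply: (le_trans fy); rewrite /f.
rewrite le_eqVlt; apply/orP; left; apply/eqP; congr `|_|.
apply: eq_bigr => j _; congr (_ * _); apply: eq_bigr => i _; rewrite ffunE.
case: (y1 i) => ->; last by rewrite eqxx expr1.
by have /negPf -> : 1 != -1 :> R by apply/eqP => h; lra.
Qed.

Section rademacher.
Variable R : realType.
Implicit Types (n : nat) (x y t : R).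

(** The constant 2 in the exponent is not sharp, which allows an elementary proof: near 0 from
    [exp u <= 1 / (1 - u)], then everywhere by repeatedly doubling the argument. *)
Lemma cosh_le_expR_sqr y : expR y + expR (- y) <= 2 * expR (2 * y ^+ 2).
Proof.
have base (z : R) : z ^+ 2 <= 1 / 4 -> expR z + expR (- z) <= 2 * expR (2 * z ^+ 2).
  move=> z4; have z1 : `|z| < 1.
    by rewrite -[_ < _]ltr_sqr ?nnegrE// real_normK ?num_real//; lra.
  move: z1; rewrite ltr_norml => /andP[zl zu].
  have inv (u : R) : u < 1 -> expR u <= (1 - u)^-1.
    move=> u1; rewrite -[u]opprK expRN opprK lef_pV2 ?posrE ?expR_gt0//; last lra.
    exact: expR_ge1Dx.
  have := inv z zu; have := inv (- z); rewrite opprK => /(_ ltac:(lra)) h1 h2.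
  have h3 := expR_ge1Dx (2 * z ^+ 2).
  have : (1 - z)^-1 + (1 + z)^-1 <= 2 * (1 + 2 * z ^+ 2); last lra.
  have -> : (1 - z)^-1 + (1 + z)^-1 = 2 / (1 - z ^+ 2).
    by field; apply/and3P; split; apply/eqP; nra.
  by rewrite ler_pdivrMr; nra.
(* With [p q = 1], one has [p^2 + q^2 = (p + q)^2 - 2 <= 4 E^2 - 2 <= 2 E^4], the last step being
   [(E^2 - 1)^2 >= 0]. *)
have doubling (z : R) : expR z + expR (- z) <= 2 * expR (2 * z ^+ 2) ->
    expR (2 * z) + expR (- (2 * z)) <= 2 * expR (2 * (2 * z) ^+ 2).
  have -> : 2 * (2 * z) ^+ 2 = 4%:R * (2 * z ^+ 2) by ring.
  rewrite -mulrN (expRM_natl 2 z) (expRM_natl 2 (- z)) (expRM_natl 4).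
  have := expR_ge0 z; have := expR_ge0 (- z).
  have : expR z * expR (- z) = 1 by rewrite -expRD subrr expR0.
  set p := expR z; set q := expR (- z); set E := expR _.
  move=> pq q0 p0 h.
  have h2 : (p + q) ^+ 2 <= 4 * E ^+ 2.
    have -> : 4 * E ^+ 2 = (2 * E) ^+ 2 by ring.
    by rewrite ler_sqr ?nnegrE//; lra.
  have E1 : 1 <= E ^+ 2 by have := sqr_ge0 (p - q); nra.
  have -> : E ^+ 4 = (E ^+ 2) ^+ 2 by rewrite -exprM.
  by have := sqr_ge0 (E ^+ 2 - 1); nra.
have [k yk] : exists k, (y / 2 ^+ k) ^+ 2 <= 1 / 4.
  exists (Num.bound (2 * `|y|)).
  set k := Num.bound _; have yk : 2 * `|y| < k%:R by exact: archi_boundP.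
  have k2 : k%:R <= 2 ^+ k :> R by rewrite -natrX ler_nat ltnW// ltn_expl.
  have p0 : 0 < 2 ^+ k :> R by rewrite exprn_gt0.
  rewrite -real_normK ?num_real// normrM [X in _ * X]gtr0_norm ?invr_gt0//.
  rewrite exprMn exprVn ler_pdivrMr ?exprn_gt0//.
  by have := normr_ge0 y; nra.
have : expR (y / 2 ^+ k) + expR (- (y / 2 ^+ k)) <=
  2 * expR (2 * (y / 2 ^+ k) ^+ 2) by exact: base.
elim: k {yk} => [|k IH]; first by rewrite expr0 divr1.
move=> /doubling; have -> : 2 * (y / 2 ^+ k.+1) = y / 2 ^+ k; last exact: IH.
by rewrite exprS; field; rewrite expf_neq0.
Qed.

Lemma sum_rademacher_mgf n (a : 'I_n -> R) t : (forall i, `|a i| = 1) ->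
  \sum_(e : {ffun 'I_n -> bool}) expR (t * \sum_i a i * (-1) ^+ e i) <=
  2 ^+ n * expR (2 * n%:R * t ^+ 2).
Proof.
move=> a1.
have -> : \sum_(e : {ffun 'I_n -> bool}) expR (t * \sum_i a i * (-1) ^+ e i) =
    \prod_(i < n) \sum_(b : bool) expR (t * (a i * (-1) ^+ b)).
  rewrite bigA_distr_bigA; apply: eq_bigr => e _.
  by rewrite mulr_sumr expR_sum.
have -> : 2 ^+ n * expR (2 * n%:R * t ^+ 2) =
    \prod_(i < n) (2 * expR (2 * t ^+ 2)).
  rewrite prodr_const card_ord exprMn -expRM_natl; congr (_ * expR _).
  by ring.
apply: ler_prod => i _; rewrite big_bool/= expr1 expr0 mulrN1 mulr1 mulrN.
rewrite addr_ge0 ?expR_ge0//= addrC.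
have -> : t ^+ 2 = (t * a i) ^+ 2.
  by rewrite exprMn -[a i ^+ 2]real_normK ?num_real// a1 expr1n mulr1.
exact: cosh_le_expR_sqr.
Qed.

(* exp (b s^2) is the moment generating function of a standard Gaussian at
   sqrt (2 b) s, which reduces the bound to the preceding lemma. *)
Lemma sum_rademacher_sqr n (a : 'I_n -> R) :
    (0 < n)%N -> (forall i, `|a i| = 1) ->
  \sum_(e : {ffun 'I_n -> bool})
    expR (3 / 32 / n%:R * (\sum_i a i * (-1) ^+ e i) ^+ 2) <= 2 ^+ n * 2.
Proof.
move=> n0 a1; have nR : 0 < n%:R :> R by rewrite ltr0n.
pose s (e : {ffun 'I_n -> bool}) := \sum_i a i * (-1) ^+ e i.
(* [q^2 / 2] is the required coefficient [3 / (32 n)], and the Rademacher bound at [t = q x] gives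
   [2 n q^2 x^2 = 3/8 x^2], the exponent of [normal_prob_exp_sqr]. *)
pose q : R := Num.sqrt (3 / 16 / n%:R).
have q2 : q ^+ 2 = 3 / 16 / n%:R.
  by rewrite sqr_sqrtr// divr_ge0// ltW.
rewrite -lee_fin -sumEFin.
have E (e : {ffun 'I_n -> bool}) : ((expR (3 / 32 / n%:R * s e ^+ 2))%:E =
    \int[normal_prob 0 1]_x (expR (q * s e * x))%:E)%E.
  by rewrite normal_prob_mgf exprMn q2; congr (expR _)%:E; field; rewrite gt_eqF.
rewrite (eq_bigr _ (fun e _ => E e)) -ge0_integral_sum//; last first.
  by move=> e; apply/measurable_EFinP; apply: measurableT_comp.
apply: (@le_trans _ _
    (\int[normal_prob 0 1]_x ((2 ^+ n)%:E * (expR (3 / 8 * x ^+ 2))%:E))%E).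
  apply: ge0_le_integral => //.
  - by move=> x _; rewrite sume_ge0// => e _; rewrite lee_fin expR_ge0.
  - apply: emeasurable_sum => e; apply/measurable_EFinP.
    by apply: measurableT_comp => //; apply: measurable_funM.
  - apply: measurable_funeM; apply/measurable_EFinP.
    apply: measurableT_comp => //; apply: measurable_funM => //.
  move=> x _; rewrite sumEFin -EFinM lee_fin.
  rewrite (eq_bigr (fun e => expR (q * x * s e))); last first.
    by move=> e _; congr expR; ring.
  apply: (le_trans (sum_rademacher_mgf _ a1)); rewrite exprMn q2.
  rewrite le_eqVlt; apply/orP; left; apply/eqP; congr (_ * expR _).
  by field; rewrite gt_eqF.
rewrite ge0_integralZl//.
  by rewrite EFinM -[X in (_ <= _ * X)%E]normal_prob_exp_sqr; exact: lexx.
apply/measurable_EFinP; apply: measurableT_comp => //.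
exact: measurable_funM.
Qed.

Lemma Bernoulli_le (u : R) k : 0 <= u -> 1 + k%:R * (u - 1) <= u ^+ k.
Proof.
move=> u0; elim: k => [|k IH]; first by rewrite mul0r addr0 expr0.
rewrite exprS; have := ler_wpM2l u0 IH.
have : 0 <= k%:R * (u - 1) ^+ 2 by rewrite mulr_ge0// sqr_ge0.
by rewrite -natr1; nra.
Qed.

(** Dividing the exponent by [k] divides the excess of the mean over 1 by [k]: Bernoulli's
    inequality gives [exp v <= 1 + (exp (k v) - 1) / k], and the mean of [exp (k v)] is at most
    2. *)
Lemma sum_rademacher_small n (a : 'I_n -> R) k :
    (0 < n)%N -> (0 < k)%N -> (forall i, `|a i| = 1) ->
  \sum_(e : {ffun 'I_n -> bool})
    expR (3 / 32 / k%:R / n%:R * (\sum_i a i * (-1) ^+ e i) ^+ 2) <=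
  2 ^+ n * (1 + k%:R^-1).
Proof.
move=> n0 k0 a1; have kR : 0 < k%:R :> R by rewrite ltr0n.
have nR : 0 < n%:R :> R by rewrite ltr0n.
pose s (e : {ffun 'I_n -> bool}) := \sum_i a i * (-1) ^+ e i.
apply: (@le_trans _ _ (\sum_(e : {ffun 'I_n -> bool})
    (1 - k%:R^-1 + k%:R^-1 * expR (3 / 32 / n%:R * s e ^+ 2)))).
  apply: ler_sum => e _; set v := (X in expR X <= _).
  have -> : 3 / 32 / n%:R * s e ^+ 2 = k%:R * v.
    by rewrite /v /s; field; rewrite !gt_eqF.
  have := Bernoulli_le k (expR_ge0 v); rewrite expRM_natl => h.
  rewrite -(ler_pM2l kR) mulrDr mulrBr mulr1 divff ?gt_eqF// mulrA.
  by rewrite divff ?gt_eqF// mul1r; lra.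
rewrite big_split/= -mulr_sumr.
rewrite [X in X + _](_ : _ = 2 ^+ n * (1 - k%:R^-1)); last first.
  by rewrite sumr_const card_ffun card_bool card_ord -[LHS]mulr_natl natrX.
have /(ler_wpM2l (_ : 0 <= k%:R^-1)) := sum_rademacher_sqr n0 a1.
rewrite invr_ge0 ler0n => /(_ isT); rewrite -/(s _) => h.
rewrite -lerBrDl; apply: (le_trans h).
by rewrite le_eqVlt; apply/orP; left; apply/eqP; ring.
Qed.

End rademacher.

(** * Measurability of the ratio *)

Section measurability.
Context (R : realType) (d : measure_display) (T : measurableType d)
  (n m : nat) (X : T -> dhomog n R m).
Hypothesis measurable_meval : forall x : 'I_n -> R,
  measurable_fun [set: T] (fun w => meval x (mpoly_of_dhomog (X w))).

(** The ends of the interval are rational already; treating them apart leaves an interior point,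
    near which the rational can be kept inside. *)
Let near_rat (f : R -> R) (y c : R) : {for y, continuous f} -> -1 <= y <= 1 ->
  c < f y -> exists2 q : rat, -1 <= (ratr q : R) <= 1 & c < f (ratr q).
Proof.
move=> fy /andP[]; rewrite le_eqVlt => /predU1P[<- _ cf|y1].
  by exists (-1); rewrite rmorphN rmorph1//; lra.
rewrite le_eqVlt => /predU1P[-> cf|y2 cf].
  by exists 1; rewrite rmorph1//; lra.
have : \forall r \near y, c < f r by exact: (cvgr_gt (f y) fy c cf).
move=> /nbhs_ballP[e /= e0 He].
have [q] : exists q : rat, ratr q \in `](Num.max (-1) (y - e)), (Num.min 1 (y + e))[.
  have : Num.max (-1) (y - e) < Num.min 1 (y + e).
    by rewrite gt_max !lt_min; apply/andP; split; apply/andP; split; lra.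
  by move=> /rat_in_itvoo[q qi]; exists q.
rewrite in_itv/= gt_max lt_min => /andP[/andP[q1 q2] /andP[q3 q4]].
exists q; first by rewrite !ltW.
by apply: He; rewrite /ball/= ltr_norml; apply/andP; split; lra.
Qed.

(** A strict lower bound survives a small change of one coordinate, so a maximizer can be made
    rational coordinate by coordinate, using continuity of one-variable polynomials only. The events
    [cube_max > c] thereby become countable unions. *)
Let cube_max_rat w c : c < cube_max (X w) ->
  exists2 q : {ffun 'I_n -> rat}, (forall i, -1 <= (ratr (q i) : R) <= 1) &
    c < `|meval (fun i => ratr (q i)) (mpoly_of_dhomog (X w))|.
Proof.
have [x x1 [-> _] cx] := cube_maxP (X w).
have [y [y1 cy] yq] : exists2 y : 'I_n -> R,
    (forall i, -1 <= y i <= 1) /\ c < `|meval y (mpoly_of_dhomog (X w))| &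
    forall i, exists q : rat, ratr q = y i.
  apply: (@coordinatewise _ _ (fun _ r => exists q : rat, ratr q = r) _ x) => //.
  move=> y i [y1 cy].
  set p := mpoly_of_dhomog (X w) in cy *.
  pose h : {poly R} := \sum_(a <- msupp p)
    (mcoeff a p * \prod_(j | j != i) y j ^+ a j) *: 'X^(a i).
  have hE r : meval (upd y i r) p = h.[r].
    rewrite mevalE horner_sum; apply: eq_bigr => a _; rewrite hornerE/=.
    rewrite hornerXn (bigD1 i)//= {1}/upd eqxx -mulrA [r ^+ _ * _]mulrC.
    congr (_ * (_ * _)); apply: eq_bigr => j /negPf ji.
    by rewrite /upd ji.
  have yE : upd y i (y i) = y.
    by apply/funext => k; rewrite /upd; case: eqP => // ->.
  have hc : {for y i, continuous (fun r => `|h.[r]|)}.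
    by apply: continuous_comp; [exact: continuous_horner|exact: norm_continuous].
  rewrite -{1}yE hE in cy; have [q q1 cq] := near_rat hc (y1 i) cy.
  exists (ratr q); first by exists q.
  split; last by rewrite hE.
  by move=> k; rewrite /upd; case: ifP.
have [q qy] := choice yq; exists [ffun i => q i].
  by move=> i; rewrite ffunE qy.
by rewrite (_ : (fun i => _) = y)//; apply/funext => i; rewrite ffunE qy.
Qed.

Lemma measurable_cube_max : measurable_fun [set: T] (fun w => cube_max (X w)).
Proof.
move=> mT; apply: (measurability _ (RGenOInfty.measurableE R)) => //.
move=> _ [_ [c ->] <-]; rewrite setTI.
rewrite (_ : _ @^-1` _ = \bigcup_(q : {ffun 'I_n -> rat})
  [set w | (forall i, -1 <= (ratr (q i) : R) <= 1) /\
    c < `|meval (fun i => ratr (q i)) (mpoly_of_dhomog (X w))| ]); last first.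
  apply/seteqP; split=> w /=; rewrite in_itv/= andbT.
    by move=> /cube_max_rat[q q1 cq]; exists q.
  move=> [q _ [q1 cq]]; have [x _ [_ /(_ _ q1)]] := cube_maxP (X w).
  exact: lt_le_trans.
apply: countable_bigcupT_measurable => // q.
have [q1|q1] := pselect (forall i, -1 <= (ratr (q i) : R) <= 1); last first.
  rewrite (_ : [set _ | _] = set0); first exact: measurable0.
  by apply/seteqP; split=> // w [].
rewrite (_ : [set _ | _] = (fun w => `|meval (fun i => ratr (q i))
    (mpoly_of_dhomog (X w))|) @^-1` `]c, +oo[); last first.
  by apply/seteqP; split=> w /=; rewrite in_itv/= andbT => // -[].
rewrite -[X in measurable X]setTI.
by apply: (measurableT_comp (@normr_measurable _ setT)) => //.
Qed.

Lemma measurable_vertex_max :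
  measurable_fun [set: T] (fun w => vertex_max (X w)).
Proof.
rewrite /vertex_max; elim: (index_enum _) => [|e s IH].
  under eq_fun do rewrite big_nil.
  exact: measurable_cst.
under eq_fun do rewrite big_cons.
apply: measurable_maxr => //.
by apply: measurableT_comp.
Qed.

Lemma measurable_ratio_gt (t : R) :
  measurable [set w | 1 - vertex_max (X w) / cube_max (X w) > t].
Proof.
(* The inverse is written as the measurable power [-1]; the two agree because [cube_max] is
   nonnegative, also where it vanishes. *)
have -> : [set w | 1 - vertex_max (X w) / cube_max (X w) > t] =
    (fun w => 1 - vertex_max (X w) * cube_max (X w) `^ (-1)) @^-1` `]t, +oo[.
  apply/seteqP; split=> w /=; rewrite in_itv/= andbT powR_inv1//;
  by have [x _ [-> _]] := cube_maxP (X w).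
rewrite -[X in measurable X]setTI.
apply: measurable_funB => //; apply: measurable_funM.
  exact: measurable_vertex_max.
apply: (measurableT_comp (@measurable_powR R (-1))).
exact: measurable_cube_max.
Qed.

End measurability.

(** * Gaussian estimates for the random polynomial *)

Lemma exponent_le (n m : nat) (a : multi_index n m) i : (exponent a i <= m)%N.
Proof.
have /eqP {2}<- := valP a; rewrite /exponent mdegE (bigD1 i)//=.
exact: leq_addr.
Qed.

Section bombieri.
Context (R : realType) (d : measure_display) (T : measurableType d)
  (P : probability T R) (n m : nat) (X : T -> dhomog n R m)
  (g : multi_index n m -> {RV P >-> R}).
Hypotheses (indep_g : mutual_independence g)
  (normal_g : forall a, standard_normal (g a)).
Hypothesis XE : forall w, X w = \sum_(a : multi_index n m)
  (Num.sqrt (multinomial_coef R a) * g a w) *: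
    (mpolyX R (exponent a)) :> mpoly n R.

Let q (a : multi_index n m) : R := Num.sqrt (multinomial_coef R a).

Let q2 a : q a ^+ 2 = multinomial_coef R a.
Proof. by rewrite sqr_sqrtr// divr_ge0. Qed.

Lemma meval_bombieri (x : 'I_n -> R) w : meval x (mpoly_of_dhomog (X w)) =
  \sum_a q a * \prod_(i < n) x i ^+ exponent a i * g a w.
Proof.
rewrite XE raddf_sum; apply: eq_bigr => a _ /=.
by rewrite mevalZ mevalX mulrAC.
Qed.

Lemma measurable_meval_bombieri (x : 'I_n -> R) :
  measurable_fun [set: T] (fun w => meval x (mpoly_of_dhomog (X w))).
Proof.
under eq_fun do rewrite meval_bombieri.
by apply: measurable_sum => a; exact: measurable_funM.
Qed.

Let linear_support (a : multi_index n m) : {set 'I_n} :=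
  [set i | (0 < exponent a i)%N]%SET.

Let squarefree_prod (x : 'I_n -> R) a : squarefree a ->
  \prod_(i < n) x i ^+ exponent a i = \prod_(i in linear_support a) x i.
Proof.
move=> /forallP sa; rewrite [RHS]big_mkcond; apply: eq_bigr => i _.
by rewrite inE; have := sa i; case: (exponent a i) => [|[|]].
Qed.

(* The monomial x^a is the diagonal restriction of the product of the
   variables (i, k) with k < a_i, which is squarefree. *)
Let slots (a : multi_index n m) : {set 'I_n * 'I_m} :=
  [set p : 'I_n * 'I_m | (p.2 < exponent a p.1)%N]%SET.

Let slots_prod (x : 'I_n -> R) a :
  \prod_(i < n) x i ^+ exponent a i = \prod_(p in slots a) x p.1.
Proof.
rewrite (eq_bigl (fun p : 'I_n * 'I_m => (p.2 < exponent a p.1)%N)); last first.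
  by move=> p; rewrite inE.
rewrite -(pair_big_dep xpredT (fun i (k : 'I_m) => (k < exponent a i)%N)
  (fun i _ => x i))/=.
apply: eq_bigr => i _.
by rewrite -(big_ord_widen m (fun=> x i)) ?exponent_le// prodr_const card_ord.
Qed.

(** Coefficients on the Gaussians of the lift of the non-squarefree part, evaluated at the signs [e]
    on the slots. The extra sign [b] lets one-sided bounds control an absolute value. *)
Let rest_coef (b : bool) (e : {ffun 'I_n * 'I_m -> bool}) a : R :=
  if squarefree a then 0 else
  (-1) ^+ b * (q a * \prod_(p in slots a) (-1) ^+ e p).

Let vertex_max_ge w (e : {ffun 'I_n -> bool}) :
  `|meval (fun i => (-1) ^+ e i) (mpoly_of_dhomog (X w))| <= vertex_max (X w).
Proof.
rewrite /vertex_max.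
exact: (le_bigmax _ (fun e : {ffun 'I_n -> bool} =>
  `|meval (fun i => (-1) ^+ e i) (mpoly_of_dhomog (X w))|) e).
Qed.

(** The bound on [Q] is spent twice, at the maximizer [x] to pass from [X] to [H], and at the vertex
    [e] to pass back: [|X x| <= |H x| + r <= |H e| + r <= |X e| + 2 r]. *)
Lemma cube_max_le_vertex_max w (r : R) :
    (forall b e, \sum_a rest_coef b e a * g a w <= r) ->
  cube_max (X w) <= vertex_max (X w) + 2 * r.
Proof.
move=> rest_r.
pose H (x : 'I_n -> R) := \sum_(a | squarefree a)
  q a * \prod_(i < n) x i ^+ exponent a i * g a w.
pose Q (x : 'I_n -> R) := \sum_(a | ~~ squarefree a)
  q a * \prod_(i < n) x i ^+ exponent a i * g a w.
have XHQ x : meval x (mpoly_of_dhomog (X w)) = H x + Q x.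
  by rewrite meval_bombieri (bigID (@squarefree n m)).
have Qr (x : 'I_n -> R) : (forall i, -1 <= x i <= 1) -> `|Q x| <= r.
  move=> x1.
  pose c a := if squarefree a then 0 else q a * g a w.
  have -> : Q x = \sum_a c a * \prod_(p in slots a) x p.1.
    rewrite /Q big_mkcond; apply: eq_bigr => a _; rewrite /c.
    by case: (squarefree a); rewrite /= ?mul0r// -(slots_prod x) mulrAC.
  have [e] := squarefree_le_vertex c slots (x := fun p => x p.1) (fun p => x1 p.1).
  move=> /le_trans; apply; set s := (X in `|X|).
  have sE (b : bool) : (-1) ^+ b * s = \sum_a rest_coef b e a * g a w.
    rewrite mulr_sumr; apply: eq_bigr => a _; rewrite /c /rest_coef.
    by case: ifP => _; [rewrite !mul0r mulr0|ring].
  have := rest_r true e; have := rest_r false e; rewrite -!sE expr0 expr1.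
  by rewrite ler_norml; move=> h1 h2; apply/andP; split; lra.
have [x x1 [-> _]] := cube_maxP (X w).
have [e He] : exists e : {ffun 'I_n -> bool},
    `|H x| <= `|H (fun i => (-1) ^+ e i)|.
  pose c a := if squarefree a then q a * g a w else 0.
  have HE y : H y = \sum_a c a * \prod_(i in linear_support a) y i.
    rewrite /H big_mkcond; apply: eq_bigr => a _; rewrite /c.
    by case: ifP => sa; rewrite ?mul0r// squarefree_prod//; ring.
  have [e He] := squarefree_le_vertex c linear_support x1.
  by exists e; rewrite !HE.
have e1 i : -1 <= ((-1) ^+ e i : R) <= 1 by case: (e i); rewrite ?expr1 ?expr0; lra.
rewrite XHQ; apply: (le_trans (ler_normD _ _)).
have := Qr _ x1; have := Qr _ e1; have := vertex_max_ge w e; rewrite XHQ.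
have := ler_normB (H (fun i => (-1) ^+ e i) + Q (fun i => (-1) ^+ e i))
  (Q (fun i => (-1) ^+ e i)).
rewrite addrK; lra.
Qed.

(** [mu] is the free Chernoff parameter, absorbed into the coefficients. The union bound runs over
    the [n m] slot signs and the global sign, hence the power of 2. *)
Lemma bombieri_rest_tail (mu t : R) : (0 < m)%N -> 0 < mu ->
  exists A : set T, [/\ measurable A,
    (P A <= (2 ^+ (n * m).+1 *
       expR (mu ^+ 2 * (m%:R ^+ 2 * n%:R ^+ m.-1) / 2 - t))%:E)%E &
    forall w, ~ A w -> cube_max (X w) <= vertex_max (X w) + 2 * (t / mu)].
Proof.
move=> m0 mu0.
pose c (u : bool * {ffun 'I_n * 'I_m -> bool}) a := mu * rest_coef u.1 u.2 a.
have cs u : \sum_a c u a ^+ 2 <= mu ^+ 2 * (m%:R ^+ 2 * n%:R ^+ m.-1).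
  rewrite (eq_bigr (fun a => mu ^+ 2 *
      if ~~ squarefree a then multinomial_coef R a else 0)); last first.
    move=> a _; rewrite /c /rest_coef exprMn; congr (_ * _).
    case: (squarefree a) => /=; first by rewrite expr0n.
    rewrite !exprMn q2 -prodrXl big1 ?mulr1; last by move=> p _; rewrite sqrr_sign.
    by rewrite sqrr_sign mul1r.
  rewrite -mulr_sumr -big_mkcond ler_pM2l ?exprn_gt0//.
  exact: sum_multinomial_coef_not_squarefree.
have [A [mA PA hA]] := gaussian_max_tail indep_g normal_g t cs.
exists A; split=> //.
  apply: (le_trans PA); rewrite lee_fin card_prod card_ffun card_prod !card_ord.
  by rewrite card_bool -expnS natrX.
move=> w /hA h; apply: cube_max_le_vertex_max => b e.
rewrite ler_pdivlMr// mulrC mulr_sumr; apply: le_trans (h (b, e)).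
by apply: ler_sum => a _; rewrite /c mulrA.
Qed.

(** Second moment method at inverse temperature [lam]: by the multinomial theorem the values at
    vertices [e] and [f] have covariance [<e, f>^m], and in particular the same variance [n^m] at
    every vertex. *)
Lemma bombieri_vertex_tail (lam k : R) : 0 < lam ->
    \sum_(e : {ffun 'I_n -> bool}) \sum_(f : {ffun 'I_n -> bool})
      expR (lam ^+ 2 * (\sum_i (-1) ^+ e i * (-1) ^+ f i) ^+ m) <=
    (2 ^+ n) ^+ 2 * (1 + k) ->
  exists A : set T, [/\ measurable A, (P A <= (4 * k)%:E)%E &
    forall w, ~ A w ->
      lam ^+ 2 * n%:R ^+ m / 2 - ln 2 < lam * vertex_max (X w)].
Proof.
move=> lam0 hk.
pose c (e : {ffun 'I_n -> bool}) a :=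
  lam * (q a * \prod_(i < n) ((-1) ^+ e i) ^+ exponent a i).
have cc e f : \sum_a c e a * c f a =
    lam ^+ 2 * (\sum_i (-1) ^+ e i * (-1) ^+ f i) ^+ m.
  rewrite -sum_multinomial_coef mulr_sumr; apply: eq_bigr => a _.
  rewrite -q2 /c (eq_bigr _ (fun i _ => exprMn _ _ _)) big_split/=; ring.
have c2 e : \sum_a c e a ^+ 2 = lam ^+ 2 * n%:R ^+ m.
  under eq_bigr do rewrite expr2.
  rewrite cc (eq_bigr (fun=> 1)); last by move=> i _; rewrite -expr2 sqrr_sign.
  by rewrite sumr_const card_ord.
have [||A [mA PA hA]] := gaussian_max_second_moment indep_g normal_g _ c2 (k := k).
- by rewrite card_ffun card_bool card_ord expn_gt0.
- rewrite card_ffun card_bool card_ord natrX; apply: le_trans hk.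
  by apply: ler_sum => e _; apply: ler_sum => f _; rewrite cc.
exists A; split=> // w /hA[e h]; apply: (lt_le_trans h).
have -> : \sum_a c e a * g a w =
    lam * meval (fun i => (-1) ^+ e i) (mpoly_of_dhomog (X w)).
  rewrite meval_bombieri mulr_sumr; apply: eq_bigr => a _.
  by rewrite /c !mulrA.
by rewrite ler_pM2l//; apply: le_trans (vertex_max_ge w e); exact: ler_norm.
Qed.

End bombieri.

(** * Choice of the parameters and tail of the ratio *)

Lemma vertex_max_le_cube_max (R : realType) (n m : nat) (p : dhomog n R m) :
  vertex_max p <= cube_max p.
Proof.
have [x x1 [Mx hM]] := cube_maxP p.
apply: bigmax_le => [|e _]; first by rewrite Mx.
by apply: hM => i; case: (e i); rewrite ?expr1 ?expr0; lra.
Qed.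

Lemma ratio_le (R : realFieldType) (V M r D : R) :
  0 < V -> V <= M -> M <= V + 2 * r -> 2 * r <= D * V -> 1 - V / M <= D.
Proof.
move=> V0 VM Mr rD; have M0 : 0 < M by exact: lt_le_trans VM.
have D0 : 0 <= D by rewrite -(pmulr_lge0 _ V0); lra.
have -> : 1 - V / M = (M - V) / M by field; rewrite gt_eqF.
by rewrite ler_pdivrMr//; have := ler_wpM2l D0 VM; lra.
Qed.

Section tails.
Context (R : realType) (d : measure_display) (T : measurableType d)
  (P : probability T R) (n m : nat) (X : T -> dhomog n R m)
  (g : multi_index n m -> {RV P >-> R}).
Hypotheses (indep_g : mutual_independence g)
  (normal_g : forall a, standard_normal (g a)).
Hypothesis XE : forall w, X w = \sum_(a : multi_index n m)
  (Num.sqrt (multinomial_coef R a) * g a w) *: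
    (mpolyX R (exponent a)) :> mpoly n R.
Hypothesis n0 : (0 < n)%N.

(** Half-integer powers of [n] are handled as natural powers of [r]. *)
Let r : R := Num.sqrt n%:R.
Let r2 : r ^+ 2 = n%:R. Proof. by rewrite sqr_sqrtr. Qed.
Let r0 : 0 < r. Proof. by rewrite sqrtr_gt0 ltr0n. Qed.
Let rm2 : (r ^+ m) ^+ 2 = n%:R ^+ m. Proof. by rewrite exprAC r2. Qed.
Let rm0 : 0 < r ^+ m. Proof. by rewrite exprn_gt0. Qed.
Let nR : 0 < n%:R :> R. Proof. by rewrite ltr0n. Qed.

(* m bounds the entropy log (2^m) of the vertices per coordinate, m^2 the
   variance term, and 1 makes the tail decay. *)
Definition rest_cst : R := m%:R + m%:R ^+ 2 + 1.

Lemma bombieri_rest_small : (0 < m)%N ->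
  exists A : set T, [/\ measurable A, (P A <= (2 / n%:R)%:E)%E &
    forall w, ~ A w ->
      cube_max (X w) <= vertex_max (X w) + 2 * (rest_cst * r ^+ m)].
Proof.
(* This [mu] brings the variance term to [m^2 n], the order of the entropy [n m]. The threshold
   [rest_cst n] exceeds both by at least [n], and [exp (- n) <= 1 / n]. *)
move=> m0; pose mu := n%:R / r ^+ m; have mu0 : 0 < mu by exact: divr_gt0.
have [A [mA PA hA]] :=
  bombieri_rest_tail indep_g normal_g XE (rest_cst * n%:R) m0 mu0.
exists A; split=> //; last first.
  have -> // : rest_cst * r ^+ m = rest_cst * n%:R / mu.
  by rewrite /mu; field; rewrite !gt_eqF.
apply: (le_trans PA); rewrite lee_fin.
have -> : mu ^+ 2 * (m%:R ^+ 2 * n%:R ^+ m.-1) = m%:R ^+ 2 * n%:R.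
  have nm : n%:R ^+ m = n%:R * n%:R ^+ m.-1 :> R by rewrite -exprS prednK.
  rewrite /mu exprMn exprVn rm2 nm; set q := n%:R ^+ m.-1.
  by field; rewrite !gt_eqF// exprn_gt0.
have e2 : 2 ^+ (n * m) <= expR (n%:R * m%:R) :> R.
  rewrite -natrM -[(n * m)%:R]mulr1 expRM_natl lerXn2r ?nnegrE ?expR_ge0//.
  by have := expR_ge1Dx (1 : R); lra.
rewrite exprS -mulrA ler_pM2l//.
apply: (le_trans (ler_wpM2r (expR_ge0 _) e2)); rewrite -expRD.
have en := expR_ge1Dx (n%:R : R).
apply: (@le_trans _ _ (expR (- n%:R))).
  rewrite ler_expR /rest_cst.
  have : 0 <= m%:R ^+ 2 * n%:R :> R by rewrite mulr_ge0 ?sqr_ge0// ltW.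
  by nra.
rewrite expRN lef_pV2 ?posrE ?expR_gt0//; lra.
Qed.

Let ln2_le1 : ln 2 <= 1 :> R.
Proof.
rewrite -[leRHS](@expRK R) ler_ln ?posrE ?expR_gt0//.
by have := expR_ge1Dx (1 : R); lra.
Qed.

Let sign_prod (e f : {ffun 'I_n -> bool}) :
  `|\sum_i (-1) ^+ e i * (-1) ^+ f i| <= n%:R :> R.
Proof.
apply: (le_trans (ler_norm_sum _ _ _)).
rewrite (eq_bigr (fun=> 1)) ?sumr_const ?card_ord// => i _.
by rewrite normrM !normr_sign mulr1.
Qed.

Let sum_sign (u : {ffun 'I_n -> bool} -> {ffun 'I_n -> bool} -> R) k :
    (forall e, \sum_f u e f <= 2 ^+ n * k) ->
  \sum_e \sum_f u e f <= (2 ^+ n) ^+ 2 * k.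
Proof.
move=> uk; apply: (le_trans (ler_sum _ (fun e _ => uk e))).
rewrite sumr_const card_ffun card_bool card_ord -[leLHS]mulr_natl natrX.
by rewrite mulrA expr2.
Qed.

(* 43 > 128 / 3 makes lam^2 n^m / 4 >= 1 >= ln 2. *)
Lemma bombieri_vertex_large k : (1 < m)%N -> (0 < k)%N -> (43 * k <= n)%N ->
  exists A : set T, [/\ measurable A, (P A <= (4 / k%:R)%:E)%E &
    forall w, ~ A w ->
      Num.sqrt (3 / 32 / k%:R) / 4 * (r * r ^+ m) < vertex_max (X w)].
Proof.
move=> m1 k0 kn; have kR : 0 < k%:R :> R by rewrite ltr0n.
pose l : R := Num.sqrt (3 / 32 / k%:R).
have l2 : l ^+ 2 = 3 / 32 / k%:R by rewrite sqr_sqrtr// divr_ge0// ltW.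
have l0 : 0 < l by rewrite sqrtr_gt0 divr_gt0.
(* Then [lam^2 n^m = l^2 n], and [|s| <= n] gives [lam^2 s^m <= l^2 s^2 / n], the exponent in
   [sum_rademacher_small]. *)
pose lam := l * r / r ^+ m; have lam0 : 0 < lam by rewrite divr_gt0// mulr_gt0.
have lam2 : lam ^+ 2 = 3 / 32 / k%:R * n%:R / n%:R ^+ m.
  by rewrite /lam !exprMn exprVn l2 r2 rm2.
have [|A [mA PA hA]] :=
  bombieri_vertex_tail indep_g normal_g XE lam0 (k := k%:R^-1).
  apply: sum_sign => e.
  have a1 i : `|(-1) ^+ e i| = 1 :> R by rewrite normr_sign.
  apply: le_trans (sum_rademacher_small n0 k0 a1).
  apply: ler_sum => f _; rewrite ler_expR lam2.
  set s := \sum_i _; have sn : `|s| <= n%:R by exact: sign_prod.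
  rewrite -!mulrA; do 3![rewrite ler_pM2l ?invr_gt0//].
  (* This is where [m >= 2] enters. *)
  have sm : s ^+ m <= n%:R ^+ m.-2 * s ^+ 2.
    apply: (le_trans (ler_norm _)); rewrite normrX.
    rewrite -{1}(subnK m1) subn2 exprD real_normK ?num_real//.
    by rewrite ler_wpM2r ?sqr_ge0// lerXn2r ?nnegrE.
  have -> : n%:R ^+ m = n%:R * n%:R * n%:R ^+ m.-2 :> R.
    by rewrite -mulrA -!exprS; congr (_ ^+ _); lia.
  have q0 : 0 < n%:R ^+ m.-2 :> R by rewrite exprn_gt0.
  rewrite -(ler_pM2l (mulr_gt0 nR q0)).
  apply: le_trans (_ : n%:R ^+ m.-2 * s ^+ 2 <= _); first apply: le_trans sm.
    by rewrite le_eqVlt; apply/orP; left; apply/eqP; field; rewrite !gt_eqF.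
  by rewrite le_eqVlt; apply/orP; left; apply/eqP; field; rewrite !gt_eqF.
exists A; split=> // w /hA h.
have E : l / 4 * (r * r ^+ m) * lam = l ^+ 2 * n%:R / 4.
  by rewrite /lam -r2; field; rewrite gt_eqF.
rewrite -(ltr_pM2l lam0) mulrC E; apply: le_lt_trans h.
have -> : lam ^+ 2 * n%:R ^+ m = l ^+ 2 * n%:R.
  by rewrite lam2 l2 mulfVK// gt_eqF// exprn_gt0.
suff : 4 <= l ^+ 2 * n%:R by have := ln2_le1; lra.
rewrite l2; have : 43 * k%:R <= n%:R :> R by rewrite -natrM ler_nat.
move=> kn'; rewrite mulrAC ler_pdivlMr//; lra.
Qed.

(** For [m = 1] the overlap [<e, f>] enters linearly, so the Rademacher generating function bounds
    the second moment directly. *)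
Lemma bombieri_vertex_pos k : m = 1 -> (0 < k)%N -> (43 * k <= n)%N ->
  exists A : set T, [/\ measurable A, (P A <= (4 / k%:R)%:E)%E &
    forall w, ~ A w -> 0 < vertex_max (X w)].
Proof.
move=> m1 k0 kn; have kR : 0 < k%:R :> R by rewrite ltr0n.
(* Chosen so that [2 n l^2 = 1 / (k + 1)], whose exponential is at most [1 + 1 / k]. As [l] is only
   of order [n^(-1/2)], [l n] still reaches 2, which makes the lower bound nonnegative. *)
pose l : R := Num.sqrt (1 / (2 * (k%:R + 1) * n%:R)).
have l0 : 0 < l by rewrite sqrtr_gt0 divr_gt0// !mulr_gt0//; lra.
have l2 : l ^+ 2 = 1 / (2 * (k%:R + 1) * n%:R).
  by rewrite sqr_sqrtr// divr_ge0// !mulr_ge0//; lra.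
pose lam := Num.sqrt l; have lam0 : 0 < lam by rewrite sqrtr_gt0.
have lam2 : lam ^+ 2 = l by rewrite sqr_sqrtr// ltW.
have [|A [mA PA hA]] :=
  bombieri_vertex_tail indep_g normal_g XE lam0 (k := k%:R^-1).
  apply: sum_sign => e; rewrite m1 lam2.
  have a1 i : `|(-1) ^+ e i| = 1 :> R by rewrite normr_sign.
  apply: (le_trans (sum_rademacher_mgf l a1)); rewrite ler_pM2l ?exprn_gt0// l2.
  have -> : 2 * n%:R * (1 / (2 * (k%:R + 1) * n%:R)) = (k%:R + 1)^-1 :> R.
    by field; rewrite !gt_eqF//; lra.
  set u := (k%:R + 1)^-1; have := expR_ge1Dx (- u).
  rewrite -[expR u]invrK -expRN => h.
  have -> : 1 + k%:R^-1 = (1 - u)^-1.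
    by rewrite /u; field; rewrite !gt_eqF//; lra.
  rewrite lef_pV2 ?posrE ?expR_gt0//.
  by rewrite subr_gt0 invf_lt1; lra.
exists A; split=> // w /hA h.
rewrite -(pmulr_rgt0 _ lam0); apply: le_lt_trans h.
rewrite m1 expr1 lam2 subr_ge0; apply: (le_trans ln2_le1).
suff : 2 <= l * n%:R by lra.
have ln0 : 0 <= l * n%:R by rewrite mulr_ge0// ltW.
rewrite -ler_sqr ?nnegrE// exprMn l2.
have : 43 * k%:R <= n%:R :> R by rewrite -natrM ler_nat.
have k1 : 1 <= k%:R :> R by rewrite ler1n.
move=> kn'.
have -> : 1 / (2 * (k%:R + 1) * n%:R) * n%:R ^+ 2 = n%:R / (2 * (k%:R + 1)) :> R.
  by field; rewrite !gt_eqF//; lra.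
by rewrite ler_pdivlMr; lra.
Qed.

Lemma bombieri_ratio_tail k : (0 < m)%N -> (0 < k)%N -> (43 * k <= n)%N ->
  (P [set w | (1 - vertex_max (X w) / cube_max (X w) >
      8 * rest_cst / Num.sqrt (3 / 32 / k%:R) * n%:R `^ (- 2^-1))%R] <=
    (4 / k%:R + 2 / n%:R)%:E)%E.
Proof.
move=> m0 k0 kn; have kR : 0 < k%:R :> R by rewrite ltr0n.
have l0 : 0 < Num.sqrt (3 / 32 / k%:R) :> R by rewrite sqrtr_gt0 divr_gt0.
have c0 : 0 < rest_cst.
  by rewrite /rest_cst; have := ler0n R m; have := sqr_ge0 (m%:R : R); lra.
rewrite powRN powR12_sqrt// -/r.
(* [D] is the ratio of [2 rest_cst r^m], the gap between the two maxima, to [l / 4 * r^(m+1)], the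
   lower bound on the vertex maximum. *)
set l := Num.sqrt _ in l0 *; set D := _ / r.
have D0 : 0 <= D by rewrite !divr_ge0 ?mulr_ge0 ?ltW.
have [A [B [mA mB PA PB hAB]]] : exists A B : set T,
    [/\ measurable A, measurable B, (P A <= (4 / k%:R)%:E)%E,
      (P B <= (2 / n%:R)%:E)%E &
      forall w, ~ A w -> ~ B w ->
        1 - vertex_max (X w) / cube_max (X w) <= D].
  have [m1|m1] := eqVneq m 1.
    have [A [mA PA hA]] := bombieri_vertex_pos m1 k0 kn.
    (* In degree 1 every monomial is squarefree, so the rest vanishes surely and the second
       exceptional event is empty. *)
    exists A, set0; split=> //; first by rewrite measure0 lee_fin divr_ge0// ltW.
    move=> w /hA V0 _; apply: (ratio_le (r := 0) V0).
    - exact: vertex_max_le_cube_max.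
    - apply: (cube_max_le_vertex_max XE) => b e.
      rewrite big1// => a _; case: ifP => [_|/negP[]]; first by rewrite mul0r.
      by apply/forallP => i; apply: leq_trans (exponent_le a i) _; rewrite m1.
    - by rewrite mulr0 mulr_ge0// ltW.
  have [A [mA PA hA]] : exists A : set T, [/\ measurable A, (P A <= (4 / k%:R)%:E)%E &
     forall w, ~ A w -> l / 4 * (r * r ^+ m) < vertex_max (X w)].
    by apply: bombieri_vertex_large => //; lia.
  have [B [mB PB hB]] := bombieri_rest_small m0.
  exists A, B; split=> // w /hA Vw /hB Mw.
  have V0 : 0 < vertex_max (X w).
    by apply: le_lt_trans Vw; rewrite !mulr_ge0 ?divr_ge0 ?ltW.
  apply: ratio_le Mw _ => //; first exact: vertex_max_le_cube_max.
  apply: le_trans (ler_wpM2l D0 (ltW Vw)).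
  by rewrite /D le_eqVlt; apply/orP; left; apply/eqP; field; rewrite !gt_eqF.
apply: (@le_trans _ _ (P (A `|` B))).
  apply: le_measure; rewrite ?inE; [|exact: measurableU|].
    exact/measurable_ratio_gt/measurable_meval_bombieri.
  move=> w /= h; apply: contrapT => /not_orP[nA nB].
  by have := hAB w nA nB; rewrite leNgt h.
apply: le_trans (@measureU2 _ _ _ P A B mA mB) _.
by rewrite EFinD leeD.
Qed.

End tails.

Theorem theorem1 (R : realType) (m : nat) (hm : (1 <= m)%N)
    (d : nat -> measure_display) (T : forall n, measurableType (d n))
    (P : forall n, probability (T n) R)
    (X : forall n, T n -> dhomog n R m)
    (hX : forall n, bombieri_gaussian (P n) (X n)) :
  bigO_in_probability P
    (fun n w => 1 - vertex_max (X n w) / cube_max (X n w))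
    (fun n => n%:R `^ (- 2^-1)).
Proof.
(* The failure probabilities [4 / k] and [2 / n] each get less than [eta / 2]. Here [k] depends on
   [eta] alone, so the constant [C] may depend on [k]. *)
move=> eta eta0; pose k := Num.bound (8 / eta).
have hk : 8 / eta < k%:R by apply: archi_boundP; rewrite divr_ge0// ltW.
have kR : 0 < k%:R :> R by apply: lt_trans hk; rewrite divr_gt0.
have k0 : (0 < k)%N by rewrite ltr0n in kR.
exists (8 * rest_cst R m / Num.sqrt (3 / 32 / k%:R)).
  rewrite divr_gt0 ?sqrtr_gt0 ?divr_gt0// mulr_gt0// /rest_cst.
  by have := ler0n R m; have := sqr_ge0 (m%:R : R); lra.
exists (maxn (43 * k) (Num.bound (4 / eta))).+1 => // n /=.
rewrite gtn_max => /andP[kn en].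
have [g [indep_g normal_g XE]] := hX n.
have n0 : (0 < n)%N by apply: leq_ltn_trans kn.
have nR : 0 < n%:R :> R by rewrite ltr0n.
apply: le_lt_trans (bombieri_ratio_tail indep_g normal_g XE n0 hm k0 (ltnW kn)) _.
have hn : 4 / eta < n%:R.
  apply: (@lt_trans _ _ (Num.bound (4 / eta))%:R); last by rewrite ltr_nat.
  by apply: archi_boundP; rewrite divr_ge0// ltW.
rewrite lte_fin; rewrite ltr_pdivrMr// in hk; rewrite ltr_pdivrMr// in hn.
have : 4 / k%:R < eta / 2 by rewrite ltr_pdivrMr//; lra.
have : 2 / n%:R < eta / 2 by rewrite ltr_pdivrMr//; lra.
lra.
Qed.
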